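(* Let $\alpha$ be a non-geodesic Legendre contact whirl curve, with Frenet frame $\{T,N,B\}$, in a Lorentzian Sasakian $3$-manifold $(M,\eta,\xi,g,\Phi)$. Then its torsion is $\tau=1$.
   Context: A contact metric Lorentzian $3$-manifold $(M,\eta,\xi,g,\Phi)$ is a smooth $3$-manifold with a contact form $\eta$, Reeb vector field $\xi$ ($\eta(\xi)=1$, $d\eta(\xi,\cdot)=0$), a Lorentzian metric $g$ with $g(\xi,\xi)=-1$, and a $(1,1)$-tensor $\Phi$ with $\Phi^2=-\mathrm{id}+\eta\otimes\xi$, $g(\Phi X,\Phi Y)=g(X,Y)+\eta(X)\eta(Y)$ and $d\eta(X,Y)=g(X,\Phi Y)$, where $d\eta(X,Y)=\tfrac12\bigl(X\eta(Y)-Y\eta(X)-\eta([X,Y])\bigr)$. In particular $\eta(X)=-g(X,\xi)$, $\eta\circ\Phi=0$, and, with $\nabla$ the Levi-Civita connection of $g$ and $h=\frac12\mathcal L_\xi\Phi$, one has $\nabla_X\xi=\Phi X-\Phi hX$. It is Lorentzian Sasakian if $\xi$ is Killing (equivalently $h=0$); then $\nabla_X\xi=\Phi X$ and $(\nabla_X\Phi)Y=g(X,Y)\xi+\eta(Y)X$. The vector product is $X\wedge Y=g(X,\Phi Y)\xi-\eta(Y)\Phi X+\eta(X)\Phi Y$. A (non-geodesic) Frenet curve is a unit-speed non-null curve $\alpha$, with $T=\alpha'$ and $g(T,T)=\varepsilon_1\in\{\pm1\}$, such that $\nabla_TT$ is non-null. It has an orthonormal Frenet frame $\{T,N,B\}$,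 with $g(N,N)=\varepsilon_2$, $g(B,B)=\varepsilon_3$, $\varepsilon_1\varepsilon_2=-\varepsilon_3$, oriented so that $T\wedge N=\varepsilon_3B$, $N\wedge B=\varepsilon_1T$, $B\wedge T=\varepsilon_2N$, and satisfying $$\nabla_TT=\varepsilon_2\kappa N,\quad \nabla_TN=-\varepsilon_1\kappa T-\varepsilon_3\tau B,\quad \nabla_TB=\varepsilon_2\tau N,$$ with curvature $\kappa>0$ and torsion $\tau$. Curves in this statement are Frenet curves in this sense. The curve is Legendre if $\eta(T)=0$ along $\alpha$. It is a contact whirl curve if there is a constant $\varrho\neq0$ with $\eta(T)=\varrho\,\eta(N)$ along $\alpha$. *)

(* Defs.v *)
(* Manifolds are given by an atlas, and tensor fields classically: one
   family of components per chart, with the transformation law on overlaps.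
   Tangent vectors are rows of components, so that the matrix 'J of a
   transition map, and the matrix of an endomorphism, act on the right.  All
   components are functions of the coordinates y, not of the point. *)
From HB Require Import structures.
From mathcomp Require Import all_boot all_order all_algebra.
From mathcomp Require Import all_classical all_reals all_analysis.
Set Implicit Arguments.
Unset Strict Implicit.
Unset Printing Implicit Defensive.
Import Order.TTheory GRing.Theory Num.Theory.
Import numFieldNormedType.Exports.
Local Open Scope classical_set_scope.
Local Open Scope ring_scope.

Section Calculus.
Context {R : realType}.
Local Notation E := 'rV[R]_3.

Definition basisv (k : 'I_3) : E := delta_mx 0 k.

Definition pderivs (V : normedModType R) (s : seq 'I_3) (f : E -> V) : E -> V :=
  foldr (fun k h => 'D_(basisv k) h) f s.

(* C^oo on an open set: all iterated partial derivatives are differentiable. *)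
Definition smooth_on (V : normedModType R) (U : set E) (f : E -> V) : Prop :=
  forall s y, U y -> differentiable (pderivs s f) y.

Definition smooth1_on (V : normedModType R) (J : set R) (f : R -> V) : Prop :=
  forall n t, J t -> derivable (derive1n n f) t 1.

Definition pairing (w v : E) : R := (v *m w^T) 0 0.

Definition form (G : 'M[R]_3) (u v : E) : R := (u *m G *m v^T) 0 0.

Definition lorentzian_form (G : 'M[R]_3) : Prop :=
  G^T = G /\
  exists P : 'M[R]_3, P \in unitmx /\
    P *m G *m P^T = diag_mx (\row_k (if k == 0 then -1 else 1)).

Definition lie_bracket (X Y : E -> E) (y : E) : E :=
  'D_(X y) Y y - 'D_(Y y) X y.

Definition ext_deriv (w X Y : E -> E) (y : E) : R :=
  2^-1 * ('D_(X y) (fun z => pairing (w z) (Y z)) y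
          - 'D_(Y y) (fun z => pairing (w z) (X z)) y
          - pairing (w y) (lie_bracket X Y y)).

Definition lie_deriv_form (Z : E -> E) (G : E -> 'M[R]_3) (X Y : E -> E)
    (y : E) : R :=
  'D_(Z y) (fun z => form (G z) (X z) (Y z)) y
  - form (G y) (lie_bracket Z X y) (Y y)
  - form (G y) (X y) (lie_bracket Z Y y).

End Calculus.

Section Manifold.
Context (R : realType).
Local Notation E := 'rV[R]_3.

(* The maps are total; their values outside cdom and its image are junk. *)
Record chart (M : topologicalType) := Chart {
  cdom : set M;
  cmap : M -> E;
  cinv : E -> M;
  cdom_open : open cdom;
  cimg_open : open (cmap @` cdom);
  cmapK : forall p, cdom p -> cinv (cmap p) = p;
  cmap_continuous : {within cdom, continuous cmap};
  cinv_continuous : {within cmap @` cdom, continuous cinv} }.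

Definition cimg (M : topologicalType) (c : chart M) : set E :=
  cmap c @` cdom c.

Definition overlap (M : topologicalType) (c c' : chart M) : set E :=
  cmap c @` (cdom c `&` cdom c').

Definition transition (M : topologicalType) (c c' : chart M) : E -> E :=
  cmap c' \o cinv c.

Record manifold3 := Manifold3 {
  carrier :> topologicalType;
  carrier_hausdorff : hausdorff_space carrier;
  carrier_second_countable : @second_countable carrier;
  chart_index : Type;
  atlas : chart_index -> chart carrier;
  atlas_cover : forall p, exists i, cdom (atlas i) p;
  atlas_smooth : forall i j,
    smooth_on (overlap (atlas i) (atlas j)) (transition (atlas i) (atlas j)) }.

End Manifold.
Arguments atlas {R} M i : rename.

Section Tensors.
Context {R : realType} (M : manifold3 R).
Local Notation E := 'rV[R]_3.
Local Notation U i := (cimg (atlas M i)).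
Local Notation ov i j := (overlap (atlas M i) (atlas M j)).
Local Notation tr i j := (transition (atlas M i) (atlas M j)).

Record vector_field := VectorField {
  vcomp :> chart_index M -> E -> E;
  vcomp_smooth : forall i, smooth_on (U i) (vcomp i);
  vcompE : forall i j y, ov i j y ->
    vcomp j (tr i j y) = vcomp i y *m 'J (tr i j) y }.

Record one_form := OneForm {
  wcomp :> chart_index M -> E -> E;
  wcomp_smooth : forall i, smooth_on (U i) (wcomp i);
  wcompE : forall i j y, ov i j y ->
    wcomp i y = wcomp j (tr i j y) *m ('J (tr i j) y)^T }.

Record lorentz_metric := LorentzMetric {
  gcomp :> chart_index M -> E -> 'M[R]_3;
  gcomp_smooth : forall i, smooth_on (U i) (gcomp i);
  gcompE : forall i j y, ov i j y ->
    gcomp i y = 'J (tr i j) y *m gcomp j (tr i j y) *m ('J (tr i j) y)^T;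
  gcomp_lorentzian : forall i y, U i y -> lorentzian_form (gcomp i y) }.

Record endo_field := EndoField {
  ecomp :> chart_index M -> E -> 'M[R]_3;
  ecomp_smooth : forall i, smooth_on (U i) (ecomp i);
  ecompE : forall i j y, ov i j y ->
    'J (tr i j) y *m ecomp j (tr i j y) = ecomp i y *m 'J (tr i j) y }.

(* Vector fields on the domain of the chart i, through their components.
   Identities between tensor fields are tested on these; being pointwise and
   C^oo-linear in the fields, they are the identities for global fields. *)
Definition local_field (i : chart_index M) (X : E -> E) : Prop := smooth_on (U i) X.

(* eta /\ d eta <> 0, evaluated on the coordinate frame *)
Definition contact_form (eta : one_form) : Prop :=
  forall i y, U i y ->
    let d a b := ext_deriv (eta i) (fun=> basisv a) (fun=> basisv b) y in
    let e a := pairing (eta i y) (basisv a) in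
    e 0 * d 1 ord_max + e 1 * d ord_max 0 + e ord_max * d 0 1 != 0.

Record contact_metric_lorentzian := ContactMetricLorentzian {
  eta : one_form;
  xi : vector_field;
  metric : lorentz_metric;
  Phi : endo_field;
  eta_contact : contact_form eta;
  eta_xi : forall i y, U i y -> pairing (eta i y) (xi i y) = 1;
  deta_xi : forall i X y, local_field i X -> U i y ->
    ext_deriv (eta i) (xi i) X y = 0;
  metric_xi : forall i y, U i y -> form (metric i y) (xi i y) (xi i y) = -1;
  Phi_sqr : forall i y (v : E), U i y ->
    v *m Phi i y *m Phi i y = - v + pairing (eta i y) v *: xi i y;
  metric_Phi : forall i y (u v : E), U i y ->
    form (metric i y) (u *m Phi i y) (v *m Phi i y)
      = form (metric i y) u v + pairing (eta i y) u * pairing (eta i y) v;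
  deta_metric : forall i X Y y, local_field i X -> local_field i Y -> U i y ->
    ext_deriv (eta i) X Y y = form (metric i y) (X y) (Y y *m Phi i y) }.

Definition killing (g : lorentz_metric) (Z : vector_field) : Prop :=
  forall i X Y y, local_field i X -> local_field i Y -> U i y ->
    lie_deriv_form (Z i) (g i) X Y y = 0.

Definition lorentzian_sasakian (S : contact_metric_lorentzian) : Prop :=
  killing (metric S) (xi S).

(* ccomp i y a b holds the components of the covariant derivative of the
   b-th coordinate field along the a-th one. *)
Record connection := Connection {
  ccomp :> chart_index M -> E -> 'I_3 -> 'I_3 -> E;
  ccomp_smooth : forall i a b, smooth_on (U i) (fun y => ccomp i y a b);
  ccompE : forall i j y a b, ov i j y ->
    ccomp i y a b *m 'J (tr i j) y
      = 'D_(basisv a) (fun z => row b ('J (tr i j) z)) y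
        + \sum_c \sum_d ('J (tr i j) y a c * 'J (tr i j) y b d)
            *: ccomp j (tr i j y) c d }.

Definition christoffel (D : connection) (i : chart_index M) (y u v : E) : E :=
  \sum_a \sum_b (u 0 a * v 0 b) *: D i y a b.

Definition nabla (D : connection) (i : chart_index M) (X Y : E -> E) (y : E) : E :=
  'D_(X y) Y y + christoffel D i y (X y) (Y y).

Definition torsion_free (D : connection) : Prop :=
  forall i X Y y, local_field i X -> local_field i Y -> U i y ->
    nabla D i X Y y - nabla D i Y X y = lie_bracket X Y y.

Definition metric_connection (g : lorentz_metric) (D : connection) : Prop :=
  forall i X Y Z y,
    local_field i X -> local_field i Y -> local_field i Z -> U i y ->
    'D_(X y) (fun z => form (g i z) (Y z) (Z z)) y
      = form (g i y) (nabla D i X Y y) (Z y)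
        + form (g i y) (Y y) (nabla D i X Z y).

Definition levi_civita (g : lorentz_metric) (D : connection) : Prop :=
  torsion_free D /\ metric_connection g D.

Definition cross (S : contact_metric_lorentzian) (i : chart_index M) (y u v : E) : E :=
  form (metric S i y) u (v *m Phi S i y) *: xi S i y
  - pairing (eta S i y) v *: (u *m Phi S i y)
  + pairing (eta S i y) u *: (v *m Phi S i y).

Record curve := Curve {
  idom : set R;
  pt :> R -> M;
  idom_neq0 : idom !=set0;
  idom_open : open idom;
  idom_itv : is_interval idom;
  pt_continuous : {within idom, continuous pt};
  pt_smooth : forall i,
    smooth1_on (idom `&` pt @^-1` cdom (atlas M i)) (cmap (atlas M i) \o pt) }.

Section Along.
Variable al : curve.

(* the parameters at which the chart i is defined *)
Definition pdom (i : chart_index M) : set R := idom al `&` al @^-1` cdom (atlas M i).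

Definition coord (i : chart_index M) : R -> E := cmap (atlas M i) \o al.

Definition velocity (i : chart_index M) : R -> E := derive1 (coord i).

Record field_along := FieldAlong {
  acomp :> chart_index M -> R -> E;
  acomp_smooth : forall i, smooth1_on (pdom i) (acomp i);
  acompE : forall i j t, pdom i t -> pdom j t ->
    acomp j t = acomp i t *m 'J (tr i j) (coord i t) }.

Definition nabla_along (D : connection) (V : chart_index M -> R -> E)
    (i : chart_index M) (t : R) : E :=
  derive1 (V i) t + christoffel D i (coord i t) (velocity i t) (V i t).

Definition orthonormal_frame (g : lorentz_metric) (e1 e2 e3 : R)
    (N B : field_along) : Prop :=
  forall i t, pdom i t ->
    let G := form (g i (coord i t)) in
    let T := velocity i t in
    [/\ G T T = e1, G (N i t) (N i t) = e2 & G (B i t) (B i t) = e3] /\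
    [/\ G T (N i t) = 0, G (N i t) (B i t) = 0 & G (B i t) T = 0].

Definition positively_oriented (S : contact_metric_lorentzian) (e1 e2 e3 : R)
    (N B : field_along) : Prop :=
  forall i t, pdom i t ->
    let X := cross S i (coord i t) in
    let T := velocity i t in
    [/\ X T (N i t) = e3 *: B i t,
        X (N i t) (B i t) = e1 *: T &
        X (B i t) T = e2 *: N i t].

Definition frenet_equations (D : connection) (e1 e2 e3 : R)
    (N B : field_along) (kappa tau : R -> R) : Prop :=
  forall i t, pdom i t ->
    let T := velocity in
    [/\ nabla_along D T i t = (e2 * kappa t) *: N i t,
        nabla_along D N i t
          = - (e1 * kappa t) *: T i t - (e3 * tau t) *: B i t &
        nabla_along D B i t = (e2 * tau t) *: N i t].

(* The curve al is a non-geodesic Frenet curve with causal characters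
   e1, e2, e3, Frenet frame {al', N, B}, curvature kappa and torsion tau. *)
Record frenet_curve (S : contact_metric_lorentzian) (D : connection)
    (e1 e2 e3 : R) (N B : field_along) (kappa tau : R -> R) : Prop :=
  FrenetCurve {
    frenet_e1 : e1 = 1 \/ e1 = -1;
    frenet_e2 : e2 = 1 \/ e2 = -1;
    frenet_e3 : e3 = 1 \/ e3 = -1;
    frenet_e123 : e1 * e2 = - e3;
    frenet_nonnull : forall i t, pdom i t ->
      form (metric S i (coord i t)) (nabla_along D velocity i t)
        (nabla_along D velocity i t) != 0;
    frenet_frame : orthonormal_frame (metric S) e1 e2 e3 N B;
    frenet_orientation : positively_oriented S e1 e2 e3 N B;
    frenet_eq : frenet_equations D e1 e2 e3 N B kappa tau;
    frenet_kappa : forall t, idom al t -> 0 < kappa t }.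

Definition legendre (S : contact_metric_lorentzian) : Prop :=
  forall i t, pdom i t -> pairing (eta S i (coord i t)) (velocity i t) = 0.

Definition contact_whirl (S : contact_metric_lorentzian) (N : field_along)
    : Prop :=
  exists2 rho : R, rho != 0 & forall i t, pdom i t ->
    pairing (eta S i (coord i t)) (velocity i t)
      = rho * pairing (eta S i (coord i t)) (N i t).

End Along.
End Tensors.

(* Main.v *)
Require Import Defs.
From mathcomp Require Import all_boot all_order all_algebra.
From mathcomp Require Import all_classical all_reals all_analysis.
From mathcomp Require Import ring lra.
Import Order.TTheory GRing.Theory Num.Theory.
Import numFieldNormedType.Exports.
Local Open Scope classical_set_scope.
Local Open Scope ring_scope.

(** On a Lorentzian Sasakian manifold the Levi-Civita connection satisfies
    nabla_X xi = Phi X.  Indeed eta = - g(., xi), so metricity and the absence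
    of torsion give 2 d eta(X, Y) = g(X, nabla_Y xi) - g(Y, nabla_X xi); as xi
    is Killing the two terms are equal, and d eta(X, Y) = g(X, Phi Y) yields
    g(Y, nabla_X xi) = - g(X, Phi Y) (lemma [nabla_xi]).

    Differentiating eta(V) = - g(V, xi) along the curve, for a field V along
    it, therefore gives (lemma [derive_eta_along])
      eta(V)' = g(T, Phi V) - g(nabla_T V, xi).
    For a Legendre contact whirl curve eta(T) = 0 and rho eta(N) = eta(T) = 0,
    so eta(N) = 0 along the whole curve.  Put a = g(T, Phi N).  Then:
    - the vector product T /\ N reduces to a xi, so e3 B = a xi, whence
      e3 g(B, xi) = - a, and a <> 0 because B is not null;
    - the Frenet equation for N gives
      g(nabla_T N, xi) = - e1 kappa g(T, xi) - e3 tau g(B, xi) = tau a.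
    Taking V = N in the derivative formula leaves 0 = a - tau a, so tau = 1.
    Differentiating the relation e3 B = a xi instead would bring in the
    derivative of a. *)

Local Notation form := Defs.form.
Local Notation coord := Defs.coord.

Section Algebra.
Context {R : realType}.
Implicit Types (G : 'M[R]_3) (u v w : 'rV[R]_3).

Lemma pairingE w v : pairing w v = \sum_k w 0 k * v 0 k.
Proof. by rewrite /pairing mxE; apply: eq_bigr => k _; rewrite mxE mulrC. Qed.

Lemma pairing0 w : pairing w 0 = 0.
Proof. by rewrite /pairing mul0mx mxE. Qed.

Lemma formC {G} u v : lorentzian_form G -> form G u v = form G v u.
Proof.
move=> [GT _]; rewrite /form -[in RHS](trmxK (v *m G *m u^T)) [in RHS]mxE.
by rewrite !trmx_mul trmxK GT mulmxA.
Qed.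

Lemma formDl G u v w : form G (u + v) w = form G u w + form G v w.
Proof. by rewrite /form !mulmxDl mxE. Qed.

Lemma formZl G a u v : form G (a *: u) v = a * form G u v.
Proof. by rewrite /form -!scalemxAl mxE. Qed.

Lemma formNl G u v : form G (- u) v = - form G u v.
Proof. by rewrite -scaleN1r formZl mulN1r. Qed.

Lemma formBl G u v w : form G (u - v) w = form G u w - form G v w.
Proof. by rewrite formDl formNl. Qed.

Lemma formBr G u v w : form G u (v - w) = form G u v - form G u w.
Proof. by rewrite /form linearB /= mulmxBr !mxE. Qed.

Lemma lie_bracketN (X Y : 'rV[R]_3 -> 'rV[R]_3) y :
  lie_bracket Y X y = - lie_bracket X Y y.
Proof. by rewrite /lie_bracket opprB. Qed.

Lemma ext_derivN (w X Y : 'rV[R]_3 -> 'rV[R]_3) y :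
  ext_deriv w Y X y = - ext_deriv w X Y y.
Proof.
rewrite /ext_deriv (lie_bracketN X Y) /pairing mulNmx mxE; ring.
Qed.

End Algebra.

Section Calculus.
Context {R : realType}.

Lemma pairing_fctE {V : Type} (w v : V -> 'rV[R]_3) :
  (fun z => pairing (w z) (v z))
    = \sum_k ((fun z => w z 0 k) * (fun z => v z 0 k)).
Proof. by apply/funext => z; rewrite pairingE fct_sumE. Qed.

Lemma smooth_on_cst (U : set 'rV[R]_3) (v : 'rV[R]_3) :
  smooth_on U (fun=> v).
Proof.
move=> s; suff [c ->] : exists c : 'rV[R]_3, pderivs s (fun=> v) = fun=> c.
  by move=> y _; exact: differentiable_cst.
elim: s => [|k s [c IH]] /=; first by exists v.
by exists 0; rewrite IH; apply/funext => y; exact: derive_cst.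
Qed.

Lemma derive_pairing {V : normedModType R} {w v : V -> 'rV[R]_3} {x u : V} :
  derivable w x u -> derivable v x u ->
  'D_u (fun z => pairing (w z) (v z)) x
    = pairing ('D_u w x) (v x) + pairing (w x) ('D_u v x).
Proof.
move=> dw dv.
have dwk k : derivable (fun z => w z 0 k) x u by move/derivable_mxP: dw; exact.
have dvk k : derivable (fun z => v z 0 k) x u by move/derivable_mxP: dv; exact.
rewrite pairing_fctE derive_sum; last by move=> k; exact: derivableM.
rewrite !pairingE -big_split; apply: eq_bigr => k _ /=.
rewrite deriveM // (derive_mx dw) (derive_mx dv) !mxE /GRing.scale /=; ring.
Qed.

End Calculus.

Section Sasakian.
Context {R : realType} {M : manifold3 R} (S : contact_metric_lorentzian M).
Context (i : chart_index M).
Local Notation E := 'rV[R]_3.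
Local Notation U := (cimg (atlas M i)).
Local Notation g y := (form (metric S i y)).
Local Notation xi := (xi S i).
Local Notation eta := (eta S i).

Lemma local_field_cst (v : E) : local_field i (fun=> v).
Proof. exact: smooth_on_cst. Qed.

Lemma local_field_xi : local_field i xi.
Proof. exact: vcomp_smooth. Qed.

(** Since d eta(Z, xi) = 0 for every Z, the compatibility of g with Phi at the
    pair (v, xi) has left-hand side g(Phi v, Phi xi) = d eta(Phi v, xi) = 0, and
    its right-hand side is g(v, xi) + eta(v). *)
Lemma metric_xiE {y} v : U y -> g y v (xi y) = - pairing (eta y) v.
Proof.
move=> Uy; have := metric_Phi S v (xi y) Uy.
rewrite eta_xi // mulr1 -(deta_metric S (local_field_cst _) local_field_xi) //.
rewrite ext_derivN deta_xi //; last exact: local_field_cst.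
lra.
Qed.

Context {D : connection M}.
Context (hD : levi_civita (metric S) D).

(** Metricity of the connection for the pair (Y, xi), read through
    eta = - g(., xi). *)
Lemma derive_eta {X Y y} : local_field i X -> local_field i Y -> U y ->
  'D_(X y) (fun z => pairing (eta z) (Y z)) y
    = - g y (nabla D i X Y y) (xi y) - g y (Y y) (nabla D i X xi y).
Proof.
move=> hX hY Uy.
(* The identity eta = - g(., xi) holds on the image of the chart only, which
   is open: the two functions have the same germ at y. *)
have oU : \forall z \near y, U z.
  by apply: open_nbhs_nbhs; split => //; exact: cimg_open.
have := hD.2 i X Y xi y hX hY local_field_xi Uy.
rewrite (@near_eq_derive _ _ _ _ (- (fun z => pairing (eta z) (Y z)))); last first.
  by near=> z; rewrite metric_xiE //; near: z.
rewrite deriveN; last first.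
  apply: diff_derivable.
  rewrite pairing_fctE; apply: differentiable_sum => k; apply: differentiableM.
    apply: (@differentiable_comp _ _ _ _ eta (fun w : E => w 0 k)).
      exact: (wcomp_smooth (Defs.eta S) [::]).
    exact: differentiable_coord.
  apply: (@differentiable_comp _ _ _ _ Y (fun w : E => w 0 k)).
    exact: (hY [::]).
  exact: differentiable_coord.
move=> /(congr1 -%R); rewrite opprK => ->; ring.
Unshelve. all: by end_near. Qed.

Context (hS : lorentzian_sasakian S).

(** Metricity along xi and the vanishing torsion turn L_xi g into the
    symmetrisation of g(nabla_. xi, .). *)
Lemma killing_nabla {X Y y} : local_field i X -> local_field i Y -> U y ->
  g y (nabla D i X xi y) (Y y) + g y (X y) (nabla D i Y xi y) = 0.
Proof.
move=> hX hY Uy; have := hS i X Y y hX hY Uy.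
rewrite /lie_deriv_form (hD.2 i xi X Y y local_field_xi hX hY Uy).
rewrite -(hD.1 i xi X y local_field_xi hX Uy).
rewrite -(hD.1 i xi Y y local_field_xi hY Uy) formBl formBr.
by move=> <-; ring.
Qed.

(** The identity nabla_X xi = Phi X, tested against Y: by the skew-symmetry of
    d eta, g(Phi X, Y) = - g(X, Phi Y). *)
Lemma nabla_xi {X Y y} : local_field i X -> local_field i Y -> U y ->
  g y (Y y) (nabla D i X xi y) = - g y (X y) (Y y *m Phi S i y).
Proof.
move=> hX hY Uy; rewrite -deta_metric // /ext_deriv !derive_eta //.
have e : pairing (eta y) (lie_bracket X Y y)
   = - g y (nabla D i X Y y) (xi y) + g y (nabla D i Y X y) (xi y).
  by rewrite -[LHS]opprK -metric_xiE // -(hD.1 i X Y y) // formBl; ring.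
have := killing_nabla hX hY Uy; rewrite e.
rewrite (formC (nabla D i X xi y) (Y y) (gcomp_lorentzian (metric S) Uy)).
lra.
Qed.

(** At a given parameter t, the product and chain rules split the derivative of
    eta(V) into the derivative of eta(V t) in the direction T, the vector V t
    being frozen in coordinates, and eta of the coordinate derivative of V.
    The constant fields with values T and V t are thus the only extensions
    needed: [derive_eta] produces the Christoffel term that completes the
    coordinate derivative into nabla_T V, and [nabla_xi] the term in Phi. *)
Lemma derive_eta_along {al : curve M} (V : field_along al) {t} :
  pdom al i t ->
  derive1 (fun s => pairing (eta (coord al i s)) (V i s)) t
    = g (coord al i t) (velocity al i t) (V i t *m Phi S i (coord al i t))
      - g (coord al i t) (nabla_along al D V i t) (xi (coord al i t)).
Proof.
move=> ht; set y := coord al i t; set T := velocity al i t.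
have Uy : U y by exists (al t) => //; exact: ht.2.
have deta : differentiable eta y by exact: (wcomp_smooth (Defs.eta S) [::]).
have dc : derivable (coord al i) t 1 by exact: (@pt_smooth _ _ al i 0 t ht).
have dV : derivable (V i) t 1 by exact: (@acomp_smooth _ _ _ V i 0 t ht).
have dcd : differentiable (coord al i) t by apply/derivable1_diffP.
have dec : differentiable (eta \o coord al i) t by exact: differentiable_comp.
have eT : 'D_1 (eta \o coord al i) t = 'D_T eta y.
  rewrite deriveE // diff_comp //= deriveE //; congr ('d _ _ _).
  by rewrite -deriveE // /T /velocity [in RHS]derive1E.
have decd : derivable (eta \o coord al i) t 1 by exact/derivable1_diffP.
rewrite derive1E (derive_pairing decd dV).
have -> : pairing ('D_1 (eta \o coord al i) t) (V i t)
    = 'D_T (fun z => pairing (eta z) (V i t)) y.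
  rewrite derive_pairing.
  - by rewrite derive_cst pairing0 addr0 eT.
  - exact: diff_derivable.
  - exact: derivable_cst.
have := derive_eta (local_field_cst T) (local_field_cst (V i t)) Uy => /= ->.
have -> := nabla_xi (local_field_cst T) (local_field_cst (V i t)) Uy.
have := metric_xiE ('D_1 (V i) t) Uy.
move=> /(congr1 -%R); rewrite opprK => <-; rewrite /nabla derive_cst add0r.
by rewrite /nabla_along formDl derive1E; ring.
Qed.

End Sasakian.

Lemma pdom_open {R : realType} {M : manifold3 R} (al : curve M) i :
  open (pdom al i).
Proof.
rewrite openE => t [It ct]; apply: filterI.
  by apply: open_nbhs_nbhs; split => //; exact: idom_open.
have := @pt_continuous _ _ al; rewrite continuous_open_subspace; last exact: idom_open.
move=> /(_ t (mem_set It)); apply.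
by apply: open_nbhs_nbhs; split => //; exact: cdom_open.
Qed.

Theorem proposition3p5 (R : realType) (M : manifold3 R)
  (S : contact_metric_lorentzian M) (D : connection M) (al : curve M)
  (e1 e2 e3 : R) (N B : field_along al) (kappa tau : R -> R)
  (hS : lorentzian_sasakian S) (hD : levi_civita (metric S) D)
  (hF : frenet_curve S D e1 e2 e3 N B kappa tau)
  (hL : legendre al S) (hW : contact_whirl S N) :
  forall t : R, idom al t -> tau t = 1.
Proof.
move=> t It; have [i ci] := atlas_cover (al t).
have ht : pdom al i t by [].
have Uy : cimg (atlas M i) (coord al i t) by exists (al t).
have etaN s : pdom al i s -> pairing (eta S i (coord al i s)) (N i s) = 0.
  move=> hs; have [rho rho0 whirl] := hW.
  apply/eqP; move: (whirl i s hs); rewrite (hL i s hs) => /esym/eqP.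
  by rewrite mulf_eq0 (negPf rho0).
have := derive_eta_along S i hD hS N ht.
rewrite derive1E (@near_eq_derive _ _ _ _ (cst 0)); last first.
  by near=> s; apply: etaN; near: s; apply: open_nbhs_nbhs; split; first exact: pdom_open.
rewrite derive_cst.
have [_ -> _] := frenet_eq hF ht.
have [TN _ _] := frenet_orientation hF ht.
have [[_ _ gB] _] := frenet_frame hF ht.
move: TN gB; rewrite /cross (hL i t ht) (etaN t ht) !scale0r subr0 addr0.
set a := form _ _ _ => /= aE gB.
have gxB : e3 * form (metric S i (coord al i t)) (B i t) (xi S i (coord al i t)) = - a.
  by rewrite -formZl -aE formZl metric_xi // mulrN1.
(* If a vanished, so would B, but g(B, B) = e3 is nonzero. *)
have a0 : a != 0.
  apply/eqP => a0; move: aE gB; rewrite a0 scale0r => /esym/eqP.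
  have e30 : e3 != 0 by case: (frenet_e3 hF) => ->; rewrite ?oppr_eq0 oner_eq0.
  rewrite scaler_eq0 (negPf e30) /= => /eqP ->.
  by rewrite /form !mul0mx mxE => /esym/eqP; rewrite (negPf e30).
rewrite formBl !formZl metric_xiE // (hL i t ht) oppr0 mulr0 sub0r opprK.
rewrite mulrAC gxB => h.
by apply: (mulIf a0); rewrite mul1r; move: h; lra.
Unshelve. all: by end_near. Qed.
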